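(* Let $\mathcal H=\mathcal H_1\otimes\cdots\otimes\mathcal H_m$ be a tensor product of $m$ finite-dimensional complex Hilbert spaces with $\dim\mathcal H=d$, let $1\le k\le m$ and $n=m-k+1$, and let $\eta_m=\{p_b,\rho_b\}_b$ be any finite ensemble of $m$-partite density operators on $\mathcal H$. Let $\epsilon_{\eta_m}=\{p_b,\sigma_b\}_b$ be the closest $(m-n+1)$-separable ensemble to $\eta_m$, and let $\mathbb R_n^m(\eta_m)=\min_b R_n(\rho_b\|\tfrac{I_d}{d})$ be the minimum random robustness of $n$-entanglement of $\eta_m$ (the superscript $m$ here stands for ''minimum''). Then for every measurement scheme $X$, $$P_X(\eta_m)\ge P_X(\epsilon_{\eta_m})\left(1+\mathbb R_n^m(\eta_m)\right)-\max_b\left(R_n(\rho_b\|\tfrac{I_d}{d})\,p_b\right).$$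
   Context: Ensembles: an ensemble $\{p_b,\rho_b\}_b$ consists of finitely many density operators $\rho_b$ on $\mathcal H$ with $p_b\ge 0$, $\sum_b p_b=1$. $k$-separability: a pure state of $\mathcal H$ is $k$-separable if it is a tensor product of $k$ pure states (each belonging to one block of some partition of the $m$ parties into $k$ nonempty blocks). A density operator on $\mathcal H$ is $k$-separable if it is a convex mixture of $k$-separable pure states (the partition may vary between the terms). The set of $k$-separable density operators is $\mathcal M_k$. Throughout $n=m-k+1$, i.e. $k=m-n+1$. Random robustness of $n$-entanglement: for a density operator $\rho$ on $\mathcal H$, $R_n(\rho\|\tfrac{I_d}{d})$ is the minimum $r\ge 0$ such that $\frac{\rho+r I_d/d}{1+r}\in\mathcal M_k$, where $I_d$ is the identity on $\mathcal H$. This minimum is finite. Closest $k$-separable ensemble: for $\eta_m=\{p_b,\rho_b\}_b$, write $\boldsymbol R_b=R_n(\rho_b\|\tfrac{I_d}{d})$ and $\sigma_b=\frac{\rho_b+\boldsymbol R_b I_d/d}{1+\boldsymbol R_b}$; then $\epsilon_{\eta_m}=\{p_b,\sigma_b\}_b$ (same probabilities). Measurement schemes: a measurement scheme $X$ is specified by a nonempty set $\boldsymbol X$ of allowed POVMs $\{M_b\}_b$ on $\mathcal H$ (so $M_b\ge 0$, $\sum_b M_b=I_d$), with outcomes indexed by the same index set as the ensemble (outcome $b$ means guessing the state with index $b$); examples are all POVMs (global), local operations, or LOCC. The optimal success probability for an ensemble $\{p_b,\tau_b\}_b$ is $P_X(\{p_b,\tau_b\}_b)=\max_{\{M_b\}\in\boldsymbol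 X}\sum_b p_b\operatorname{Tr}[M_b\tau_b]$ (read as a supremum if the maximum is not attained). *)

(* Defs.v *)
From HB Require Import structures.
From mathcomp Require Import all_boot all_order all_algebra.
From mathcomp Require Import complex.
From mathcomp Require Import boolp classical_sets reals.

Set Implicit Arguments.
Unset Strict Implicit.
Unset Printing Implicit Defensive.

Import Order.TTheory GRing.Theory Num.Theory.

Local Open Scope classical_set_scope.
Local Open Scope ring_scope.
Local Open Scope sesquilinear_scope.
Local Open Scope complex_scope.

(* The product basis of the tensor product over i : I of the spaces C^(d i):
   a basis vector is a choice of one basis index for each party i.  Kets and
   operators on that tensor product are coordinate vectors and matrices over
   this basis, enumerated by enum_rank / enum_val. *)
Definition basis (I : finType) (d : I -> nat) : finType :=
  {dffun forall i : I, 'I_(d i)}.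

Definition hdim (I : finType) (d : I -> nat) : nat := #|basis d|.

Definition ket (R : realType) (I : finType) (d : I -> nat) : Type :=
  'cV[R[i]]_(hdim d).

Definition operator (R : realType) (I : finType) (d : I -> nat) : Type :=
  'M[R[i]]_(hdim d).

Section Quantum.
Context {R : realType}.

(* On R[i], 0 <= z means that z is real and nonnegative, so a psd matrix is in
   particular Hermitian. *)
Definition psd N (A : 'M[R[i]]_N) : Prop :=
  forall v : 'cV[R[i]]_N, 0 <= (v ^t* *m A *m v) 0 0.

Definition density N (rho : 'M[R[i]]_N) : Prop := psd rho /\ \tr rho = 1.

Definition unit_vector N (v : 'cV[R[i]]_N) : Prop := (v ^t* *m v) 0 0 = 1.

Definition pure_state N (v : 'cV[R[i]]_N) : 'M[R[i]]_N := v *m v ^t*.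

Definition max_mixed N : 'M[R[i]]_N := (N%:R)^-1 *: 1%:M.

Definition ensemble N (J : finType) (p : J -> R) (rho : J -> 'M[R[i]]_N) :
    Prop :=
  [/\ forall b, 0 <= p b, \sum_b p b = 1 & forall b, density (rho b)].

Definition povm N (J : finType) (M : J -> 'M[R[i]]_N) : Prop :=
  (forall b, psd (M b)) /\ \sum_b M b = 1%:M.

(* A measurement scheme is the set of POVMs it allows. *)
Definition measurement_scheme N (J : finType) (X : set (J -> 'M[R[i]]_N)) :
    Prop :=
  X !=set0 /\ X `<=` [set M | povm M].

(* The traces are real, since M b and tau b are positive semidefinite. *)
Definition success_prob N (J : finType) (p : J -> R)
    (tau M : J -> 'M[R[i]]_N) : R :=
  \sum_b p b * complex.Re (\tr (M b *m tau b)).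

Definition opt_success_prob N (J : finType) (X : set (J -> 'M[R[i]]_N))
    (p : J -> R) (tau : J -> 'M[R[i]]_N) : R :=
  sup [set success_prob p tau M | M in X].

Section Multipartite.
Context {m : nat} (d : 'I_m -> nat).

Definition block_dims (B : {set 'I_m}) : {i : 'I_m | i \in B} -> nat :=
  fun i => d (val i).
Arguments block_dims : clear implicits.

Definition restrict_block (B : {set 'I_m}) (x : basis d) : basis (block_dims B) :=
  [ffun i => x (val i)].

(* The tensor product of the kets phi B on the blocks B of P, reordered so that
   the tensor factors follow the order of the parties. *)
Definition tensor_ket (P : {set {set 'I_m}})
    (phi : forall B : {set 'I_m}, ket R (block_dims B)) : ket R d :=
  \col_j \prod_(B in P) phi B (enum_rank (restrict_block B (enum_val j))) 0.

(* finset.partition P D includes that the blocks of P are nonempty. *)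
Definition ksep_ket (k : nat) (psi : ket R d) : Prop :=
  exists (P : {set {set 'I_m}})
         (phi : forall B : {set 'I_m}, ket R (block_dims B)),
    [/\ finset.partition P [set: 'I_m]%SET, #|P| = k,
        forall B, B \in P -> unit_vector (phi B)
      & psi = tensor_ket P phi].

Definition kseparable (k : nat) (sigma : operator R d) : Prop :=
  density sigma /\
  exists (N : nat) (q : 'I_N -> R) (psi : 'I_N -> ket R d),
    [/\ forall j, 0 <= q j, \sum_j q j = 1, forall j, ksep_ket k (psi j)
      & sigma = \sum_j (q j)%:C *: pure_state (psi j)].

Definition noise_mixture (r : R) (rho : operator R d) : operator R d :=
  ((1 + r)^-1)%:C *: (rho + r%:C *: max_mixed (hdim d)).

(* For a density operator rho this infimum is a minimum: the set is closed, and
   it is nonempty because the maximally mixed state is interior to the fully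
   separable states. *)
Definition random_robustness (n : nat) (rho : operator R d) : R :=
  inf [set r : R | 0 <= r /\ kseparable (m - n + 1)%N (noise_mixture r rho)].

(* The closest (m - n + 1)-separable ensemble keeps the probabilities, so only
   its states are given. *)
Definition closest_states (n : nat) (J : finType) (rho : J -> operator R d) :
    J -> operator R d :=
  fun b => noise_mixture (random_robustness n (rho b)) (rho b).

(* J is finite and nonempty whenever it indexes an ensemble, so inf (here) and
   sup (below) are the minimum and the maximum. *)
Definition min_robustness (n : nat) (J : finType) (rho : J -> operator R d) :
    R :=
  inf (range (fun b => random_robustness n (rho b))).

Definition max_weighted_robustness (n : nat) (J : finType) (p : J -> R)
    (rho : J -> operator R d) : R :=
  sup (range (fun b => random_robustness n (rho b) * p b)).

End Multipartite.
End Quantum.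

(* Main.v *)
(* Write R_b for the robustness of rho_b and D for the total dimension.  For a
   fixed measurement M, (1 + R_b) Tr[M_b sigma_b] equals
   Tr[M_b rho_b] + R_b Tr[M_b] / D.  Weight by p_b and sum over b.  On the left
   Tr[M_b sigma_b] >= 0, so 1 + R_b may be lowered to 1 + min R; on the right
   the weights Tr[M_b] / D are nonnegative and sum to 1, so the noise term is at
   most max_b (R_b p_b).  Then take the supremum over M. *)

Require Import Defs.
From mathcomp Require Import all_boot all_order all_algebra.
From mathcomp Require Import complex.
From mathcomp Require Import boolp classical_sets reals.

Import Order.TTheory GRing.Theory Num.Theory.
Local Open Scope ring_scope.
Local Open Scope sesquilinear_scope.
Local Open Scope complex_scope.

Lemma mulmx_delta_quad (C : numClosedFieldType) N (B : 'M[C]_N) i j (a b : C) :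
  let v : 'cV[C]_N := a *: delta_mx i 0 + b *: delta_mx j 0 in
  (v ^t* *m B *m v) 0 0 =
    a^* * a * B i i + a^* * b * B i j + (b^* * a * B j i + b^* * b * B j j).
Proof.
have entry k l : (delta_mx k (0 : 'I_1) : 'cV[C]_N)^T *m B
    *m (delta_mx l (0 : 'I_1) : 'cV[C]_N) = (B k l)%:M.
  by rewrite trmx_delta -rowE -colE; apply/matrixP=> x y; rewrite !ord1 !mxE eqxx.
rewrite /=; have -> : (a *: delta_mx i 0 + b *: delta_mx j 0 : 'cV[C]_N) ^t* =
    a^* *: (delta_mx i 0)^T + b^* *: (delta_mx j 0)^T.
  by apply/matrixP => x y; rewrite !mxE rmorphD !rmorphM /= !conjC_nat.
rewrite !mulmxDl !mulmxDr -!scalemxAl -!scalemxAr !entry !mxE /= !mulr1n.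
by rewrite !mulrA.
Qed.

(* Polarization at the vectors e_i, e_j, e_i + e_j and e_i + 'i e_j. *)
Lemma quad_eq0 (C : numClosedFieldType) N (B : 'M[C]_N) :
  (forall v : 'cV[C]_N, (v ^t* *m B *m v) 0 0 = 0) -> B = 0.
Proof.
move=> B0; apply/matrixP => i j; rewrite mxE.
have polar a b := etrans (esym (mulmx_delta_quad _ _ B i j a b)) (B0 _).
have := polar 1 0; have := polar 0 1; have := polar 1 1; have := polar 1 'i%R.
rewrite !(conjC0, conjC1, conjCi, mul0r, mulr0, mul1r, mulr1, addr0, add0r).
move=> Hi H1 Hjj Hii; move: Hi H1; rewrite Hii Hjj !mulr0 !addr0 !add0r => Hi.
move/eqP; rewrite addrC addr_eq0 => /eqP Bji; move: Hi.
rewrite Bji mulrNN -mulr2n => /eqP.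
by rewrite mulrn_eq0 /= mulf_eq0 (negPf (neq0Ci _)) /= => /eqP.
Qed.

Section PositiveSemidefinite.
Context {R : realType}.

(** The quadratic form of [A] is real at every vector, so that of [A ^t* - A] vanishes identically
    and polarization ([quad_eq0]) applies. *)
Lemma psd_hermitian N (A : 'M[R[i]]_N) : psd A -> A ^t* = A.
Proof.
move=> Apsd; apply/eqP; rewrite -subr_eq0; apply/eqP/quad_eq0 => v.
rewrite mulmxBr mulmxBl mxE [X in _ + X]mxE; apply/eqP; rewrite subr_eq0; apply/eqP.
have <- : ((v ^t* *m A *m v) ^t* ) 0 0 = (v ^t* *m A ^t* *m v) 0 0.
  by rewrite !trmx_mul !map_mxM trmxCK mulmxA.
by rewrite !mxE; apply: CrealP; apply: ger0_real; have := Apsd v; rewrite !mxE.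
Qed.

(** This entry is the quadratic form of [A] at column [i] of [U ^t*]. *)
Lemma psd_conj_diag_ge0 N (A U : 'M[R[i]]_N) i :
  psd A -> 0 <= (U *m A *m U ^t* ) i i.
Proof.
move=> /(_ (col i (U ^t* ))) h; apply: le_trans h _.
suff -> : (U *m A *m U ^t* ) i i
    = ((col i (U ^t* )) ^t* *m A *m col i (U ^t* )) 0 0 by [].
have -> : (col i (U ^t* )) ^t* = row i U.
  by apply/matrixP=> x y; rewrite !mxE conjCK.
by rewrite -row_mul !mxE; apply: eq_bigr => j _; rewrite !mxE.
Qed.

(** Diagonalizing [A] by a unitary [U] turns the trace into the sum of the eigenvalues of [A]
    weighted by the diagonal entries of [U *m B *m U ^t*]. *)
Lemma psd_mxtrace_mul_ge0 N (A B : 'M[R[i]]_N) :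
  psd A -> psd B -> 0 <= \tr (A *m B).
Proof.
move=> Apsd Bpsd.
have /orthomx_spectralP : A \is normalmx by apply/normalmxP; rewrite psd_hermitian.
have Uun := spectral_unitarymx A.
set U := spectralmx A in Uun *; set D := spectral_diag A.
rewrite invmx_unitary // => EA.
have ED : diag_mx D = U *m A *m U ^t*.
  by rewrite EA !mulmxA mulmxtVK // (unitarymxP Uun) mul1mx.
rewrite EA -!mulmxA mxtrace_mulC -!mulmxA mul_diag_mx.
apply: sumr_ge0 => i _; rewrite mxE mulr_ge0 //.
  (* The eigenvalues are themselves diagonal entries of [U *m A *m U ^t*]. *)
  by have := psd_conj_diag_ge0 N A U i Apsd; rewrite -ED !mxE eqxx mulr1n.
by rewrite mulmxA; apply: psd_conj_diag_ge0.
Qed.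

Lemma psdD N (A B : 'M[R[i]]_N) : psd A -> psd B -> psd (A + B).
Proof. by move=> hA hB v; rewrite mulmxDr mulmxDl mxE addr_ge0. Qed.

Lemma psdZ N (c : R[i]) (A : 'M[R[i]]_N) : 0 <= c -> psd A -> psd (c *: A).
Proof.
by move=> c0 hA v; rewrite -scalemxAr -scalemxAl mxE mulr_ge0.
Qed.

Lemma psd0 N : psd (0 : 'M[R[i]]_N).
Proof. by move=> v; rewrite mulmx0 mul0mx mxE. Qed.

Lemma psd1 N : psd (1%:M : 'M[R[i]]_N).
Proof.
move=> v; rewrite mulmx1 mxE sumr_ge0 // => i _.
by rewrite !mxE mulrC mul_conjC_ge0.
Qed.

End PositiveSemidefinite.

Section NoiseMixture.
Context {R : realType}.

Lemma ReZ (x : R) (z : R[i]) : complex.Re (x%:C * z) = x * complex.Re z.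
Proof. by case: z => u v /=; rewrite mul0r subr0. Qed.

Lemma ReD (z w : R[i]) : complex.Re (z + w) = complex.Re z + complex.Re w.
Proof. by case: z => u v; case: w. Qed.

Lemma Re_sum (J : finType) (F : J -> R[i]) :
  complex.Re (\sum_b F b) = \sum_b complex.Re (F b).
Proof. by apply: (big_morph (@complex.Re R)) => //; apply: ReD. Qed.

Lemma Re_ge0 (z : R[i]) : 0 <= z -> 0 <= complex.Re z.
Proof. by rewrite lecE => /andP[]. Qed.

Lemma invn_complex N : (N%:R : R[i])^-1 = ((N%:R)^-1 : R)%:C.
Proof. by rewrite fmorphV rmorph_nat. Qed.

Context {m : nat} {d : 'I_m -> nat}.
Implicit Types (rho M : operator R d).

Lemma noise_mixture_psd (r : R) rho : 0 <= r -> psd rho ->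
  psd (noise_mixture r rho).
Proof.
move=> r0 rho_psd; apply: psdZ; first by rewrite lecR invr_ge0 addr_ge0.
apply/psdD => //; apply/psdZ; first by rewrite lecR.
by apply/psdZ/psd1; rewrite invr_ge0 ler0n.
Qed.

Lemma Re_mxtrace_mul_noise_mixture (r : R) M rho : 0 <= r ->
  (1 + r) * complex.Re (\tr (M *m noise_mixture r rho)) =
  complex.Re (\tr (M *m rho)) + r * (complex.Re (\tr M) / (hdim d)%:R).
Proof.
move=> r0; have r1 : 1 + r != 0 by rewrite gt_eqF // ltr_pwDl.
rewrite /noise_mixture /max_mixed -scalemxAr mulmxDr -!scalemxAr mulmx1.
rewrite mxtraceZ mxtraceD !mxtraceZ ReZ mulrA divff // mul1r ReD ReZ.
by rewrite invn_complex ReZ [_ / _]mulrC.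
Qed.

Lemma random_robustness_ge0 n rho : 0 <= random_robustness n rho.
Proof.
rewrite /random_robustness; set S := (X in inf X).
(* On the empty set [inf] has the default value 0; otherwise 0 is a lower bound of [S]. *)
have [->|/set0P S0] := eqVneq S set0; first by rewrite inf0.
by apply: lb_le_inf => // x [].
Qed.

End NoiseMixture.

Section SuccessProbability.
Context {R : realType} {N : nat} {J : finType}.
Implicit Types (p : J -> R) (rho M : J -> 'M[R[i]]_N).

(** By completeness, [1%:M - M b] is the sum of the other effects. *)
Lemma povm_le1 M b : povm M -> psd (1%:M - M b).
Proof.
case=> Mpsd <-; rewrite (bigD1 b) //= addrAC subrr add0r.
by elim/big_ind: _ => [|A B|c _]; [exact: psd0|exact: psdD|exact: Mpsd].
Qed.

(** Bounds the set of success probabilities, so that its [sup] really dominates each member. Each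
    trace is at most 1 because [1%:M - M b] and [rho b] are both psd. *)
Lemma success_prob_le1 p rho M : ensemble p rho -> povm M ->
  success_prob p rho M <= 1.
Proof.
case=> p0 <- rhoD hM; apply: ler_sum => b _; rewrite -[leRHS]mulr1.
apply: ler_wpM2l => //; have [rho_psd rho1] := rhoD b.
have /Re_ge0 := psd_mxtrace_mul_ge0 _ _ _ (povm_le1 _ b hM) rho_psd.
by rewrite mulmxBl mul1mx linearB /= rho1 -subr_ge0; case: (\tr _).
Qed.

Lemma sum_Re_mxtrace_povm M : povm M -> \sum_b complex.Re (\tr (M b)) = N%:R.
Proof.
case=> _ hM; rewrite -Re_sum -linear_sum /= hM mxtrace1.
by rewrite -(rmorph_nat (real_complex R)).
Qed.

End SuccessProbability.

Lemma density_dim_neq0 (R : realType) N (rho : 'M[R[i]]_N) :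
  density rho -> N != 0%N.
Proof.
case: N rho => // rho [_]; rewrite /mxtrace big_ord0 => /esym/eqP.
by rewrite oner_eq0.
Qed.

Section FiniteRange.
Context {R : realType} {J : finType}.

Lemma inf_range_le (f : J -> R) b : inf (range f) <= f b.
Proof.
apply: ge_inf; last by exists b.
(* As [J] is finite, the sum of all absolute values gives an explicit bound. *)
exists (- \sum_c `|f c|) => _ [c _ <-].
rewrite lerNl; apply: (@le_trans _ _ `|f c|); first by rewrite -normrN ler_norm.
by rewrite (bigD1 c) //= lerDl sumr_ge0.
Qed.

Lemma sup_range_ge (f : J -> R) b : f b <= sup (range f).
Proof.
apply: ub_le_sup; last by exists b.
exists (\sum_c `|f c|) => _ [c _ <-].
apply: (@le_trans _ _ `|f c|); first by rewrite ler_norm.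
by rewrite (bigD1 c) //= lerDl sumr_ge0.
Qed.

End FiniteRange.

Lemma success_prob_closest_states (R : realType) (m n : nat) (d : 'I_m -> nat)
    (J : finType) (p : J -> R) (rho M : J -> operator R d) :
    ensemble p rho -> povm M ->
  success_prob p (closest_states n rho) M * (1 + min_robustness n rho) <=
  success_prob p rho M + max_weighted_robustness n p rho.
Proof.
move=> [p0 psum rhoD] hM.
(* Probabilities summing to 1 force an index [b] to exist, and trace 1 of [rho b] rules out
   dimension 0. *)
have hdim0 : (hdim d)%:R != 0 :> R.
  case: (pickP J) => [b _|J0].
    by rewrite pnatr_eq0 (density_dim_neq0 _ _ _ (rhoD b)).
  by move: psum; rewrite big_pred0 // => /esym/eqP; rewrite oner_eq0.
pose t b := complex.Re (\tr (M b)) / (hdim d)%:R.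
have t0 b : 0 <= t b.
  rewrite divr_ge0 // Re_ge0 // -[M b]mulmx1.
  by apply: psd_mxtrace_mul_ge0; [exact: hM.1 | exact: psd1].
have t1 : \sum_b t b = 1 by rewrite -mulr_suml sum_Re_mxtrace_povm ?divff.
(* Multiplying the maximum by the sum of the weights [t b], which is 1, makes both sides sums over
   [J], to be compared term by term. *)
rewrite -[max_weighted_robustness _ _ _]mulr1 -[in leRHS]t1 mulr_sumr mulr_suml.
rewrite -big_split /=; apply: ler_sum => b _.
set r := random_robustness n (rho b).
have r0 : 0 <= r by apply: random_robustness_ge0.
set s := complex.Re (\tr (M b *m closest_states n rho b)).
have s0 : 0 <= s.
  apply/Re_ge0/psd_mxtrace_mul_ge0; first exact: hM.1.
  by apply: noise_mixture_psd => //; case: (rhoD b).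
apply: (@le_trans _ _ (p b * ((1 + r) * s))).
  rewrite -mulrA ler_wpM2l // mulrC ler_wpM2r // lerD2l.
  exact: (inf_range_le (fun b => random_robustness n (rho b))).
(* The [rho b] terms cancel, leaving [r * p b] against its maximum, both weighted by [t b]. *)
rewrite Re_mxtrace_mul_noise_mixture // mulrDr lerD2l mulrA -/(t b) ler_wpM2r //.
rewrite mulrC.
exact: (sup_range_ge (fun b => random_robustness n (rho b) * p b)).
Qed.

Theorem theorem2 (R : realType) (m k n : nat) (hk : (1 <= k <= m)%N)
    (hn : n = (m - k + 1)%N) (d : 'I_m -> nat)
    (J : finType) (p : J -> R) (rho : J -> operator R d)
    (heta : ensemble p rho)
    (X : set (J -> operator R d)) (hX : measurement_scheme X) :
  opt_success_prob X p rho >=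
    opt_success_prob X p (closest_states n rho) * (1 + min_robustness n rho)
    - max_weighted_robustness n p rho.
Proof.
have [[M0 XM0] Xpovm] := hX.
have min0 : 0 <= min_robustness n rho.
  apply: lb_le_inf => [|_ [b _ <-]]; last exact: random_robustness_ge0.
  case: heta => _ psum _; case: (pickP J) => [b _|J0].
    by exists (random_robustness n (rho b)), b.
  by move: psum; rewrite big_pred0 // => /esym/eqP; rewrite oner_eq0.
have min1 : 0 < 1 + min_robustness n rho by rewrite ltr_pwDl.
(* Dividing by the positive factor isolates the supremum for the closest ensemble, so it suffices to
   bound each allowed measurement. *)
rewrite lerBlDr -ler_pdivlMr //; apply: ge_sup.
  by exists (success_prob p (closest_states n rho) M0), M0.
move=> _ [M XM <-]; rewrite ler_pdivlMr //.
apply: le_trans (success_prob_closest_states _ _ n _ _ _ _ _ heta (Xpovm _ XM)) _.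
rewrite lerD2r; apply: ub_le_sup; last by exists M.
by exists 1 => _ [M' XM' <-]; apply: success_prob_le1 => //; apply: Xpovm.
Qed.
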